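(* Assume $x(0)=x'(0)=0$. The following are equivalent: (C) $y_1(t)\to0$ as $t\to\infty$, and \[ \int_0^t\cos(\omega s)A(s)y_1(s)\,ds=o(A(t)),\qquad \int_0^t\sin(\omega s)A(s)y_1(s)\,ds=o(A(t))\quad (t\to\infty); \] (D) $x(t)\to0$ and $x'(t)\to0$ as $t\to\infty$.
   Context: Standing assumptions: $\omega>0$ is a constant; $p\in C^1([0,\infty))$ with $p(t)>0$ and $p'(t)<0$ for all $t\ge0$, $\int_0^\infty p(t)\,dt=\infty$ and $\int_0^\infty p(t)^2\,dt<\infty$; $f\in L^1_{\mathrm{loc}}([0,\infty))$. $x$ denotes the solution of $x''(t)+p(t)x'(t)+\omega^2x(t)=f(t)$, $t\ge0$. Notation: $A(t)=\exp(\frac12\int_0^tp(s)\,ds)$ (so $A(t)\to\infty$); $y_1(t)=\int_0^te^{-\omega^2(t-s)}f(s)\,ds$. *)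

(* Defs.v *)
From HB Require Import structures.
From mathcomp Require Import all_boot all_order all_algebra.
From mathcomp Require Import all_classical all_reals all_analysis.
Set Implicit Arguments. Unset Strict Implicit. Unset Printing Implicit Defensive.
Import Order.TTheory GRing.Theory Num.Theory.
Import numFieldNormedType.Exports.
Local Open Scope classical_set_scope.
Local Open Scope ring_scope.

Section Defs.
Variable R : realType.
Local Notation mu := (@lebesgue_measure R).

Definition Afun (p : R -> R) (t : R) : R :=
  expR (2^-1 * Rintegral mu `[0, t] p).

Definition y1 (w : R) (f : R -> R) (t : R) : R :=
  Rintegral mu `[0, t] (fun s => expR (- (w ^+ 2) * (t - s)) * f s).

Definition loc_integrable (f : R -> R) : Prop :=
  forall t, 0 <= t -> mu.-integrable `[0, t] (EFin \o f).

(* (x, v) is a (Caratheodory) solution on [0,oo) of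
   x'' + p x' + w^2 x = f, with v = x', written in integral form:
   x(t) = x(0) + int_0^t v,  v(t) = v(0) + int_0^t (f - p v - w^2 x). *)
Definition ode_solution (w : R) (p f x v : R -> R) : Prop :=
  forall t, 0 <= t ->
    [/\ mu.-integrable `[0, t] (EFin \o v),
        mu.-integrable `[0, t]
          (fun s => (f s - p s * v s - w ^+ 2 * x s)%:E),
        x t = x 0 + Rintegral mu `[0, t] v &
        v t = v 0 + Rintegral mu `[0, t]
                      (fun s => f s - p s * v s - w ^+ 2 * x s)].
End Defs.

(* The filter t -> +oo on R, packaged as a filter_on so that the Landau
   notation  f =o_at_pinfty g  (little-o as t -> +oo) can be used. *)
Definition at_pinfty {R : realType} : filter_on R :=
  FilterType (pinfty_nbhs R) _.

(* Main.v *)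
Require Import Defs.
From HB Require Import structures.
From mathcomp Require Import all_boot all_order all_algebra.
From mathcomp Require Import all_classical all_reals all_analysis.
From mathcomp Require Import measurable_realfun.
From mathcomp Require Import ring lra.
Import Order.TTheory GRing.Theory Num.Theory.
Import numFieldNormedType.Exports.
Local Open Scope classical_set_scope.
Local Open Scope ring_scope.

(** Put y = y_1 and u = x' - y. Since y' = f - w^2 y, the rough forcing f cancels:
    x' = u + y and u' = - p x' - w^2 x + w^2 y, with y continuous. If x and x'
    tend to 0 this gives u' = - w^2 u + o(1), so u and hence y tend to 0.
    When y tends to 0, pass to the rotating frame
      a1 = w x cos(wt) - U sin(wt),  a2 = w x sin(wt) + U cos(wt),
    with U = u + p x / 2, and to the normalised integrals
      C = A^-1 int cos(ws) A y ds,  S = A^-1 int sin(ws) A y ds.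
    The differences r1 = a1 - w C + w^2 S and r2 = a2 - w S - w^2 C satisfy
    r' = - (p / 2) r + (terms of size p |y| + (p^2 / 4 - p' / 2) |x|).
    As p^2 / 4 - p' / 2 is integrable while p is not, a Gronwall argument for
    r1^2 + r2^2 yields r -> 0, so (a1, a2) and (C, S) vanish together. *)

(** * Gronwall-type criteria for decay to zero *)

Lemma der_nincr {R : realType} (g dg : R -> R) (a t : R) :
  (forall s, a <= s -> is_derive s (1 : R) g (dg s)) ->
  (forall s, a <= s -> dg s <= 0) -> a <= t -> g t <= g a.
Proof.
move=> dgE dg0 at_.
apply: (@ler0_derive1_nincry _ g a) => //.
- by move=> s; rewrite in_itv/= andbT => /ltW/dgE[].
- move=> s; rewrite in_itv/= andbT => /ltW as_.
  by have [_] := dgE s as_; rewrite derive1E => ->; exact: dg0.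
- apply: derivable_within_continuous => s; rewrite in_itv/= andbT.
  by move=> /dgE[].
Qed.

(* The multiplier [exp (P - c Q)] turns the hypothesis into
   [(exp (P - c Q) n)' <= d (exp P (Q + 1))'], and [Q] is bounded. *)
Lemma gronwall_cvg0 {R : realType} (P dP Q dQ n dn d : R -> R) (c M : R) :
  (forall t : R, 0 < t -> is_derive t (1 : R) P (dP t)) ->
  (forall t : R, 0 < t -> is_derive t (1 : R) Q (dQ t)) ->
  (forall t : R, 0 < t -> is_derive t (1 : R) n (dn t)) ->
  (forall t : R, 0 < t -> 0 <= dP t) -> (forall t : R, 0 < t -> 0 <= dQ t) ->
  (forall t : R, 0 < t -> 0 <= Q t <= M) -> (forall t : R, 0 < t -> 0 <= n t) ->
  0 <= c -> P t @[t --> +oo] --> +oo -> d t @[t --> +oo] --> 0 ->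
  (forall t : R, 0 < t ->
     dn t <= - dP t * n t + c * dQ t * n t + d t * (dP t + dQ t)) ->
  n t @[t --> +oo] --> 0.
Proof.
move=> P' Q' n' dP0 dQ0 QM n0 c0 Poo d0 ndn.
apply/cvgr0Pnorm_le => e e0.
pose K := expR (c * M).
have K0 : 0 < K by exact: expR_gt0.
have M0 : 0 <= M by have /andP[] := QM 1 ltr01; exact: le_trans.
(* [e1] is fixed by the final bound [K * (e1 * (M + 2))]: [K] bounds exp (c Q), [M + 1] bounds
   [Q + 1], and the last unit pays for the constant [g a]. *)
pose e1 := e / (K * (M + 2)).
have KM0 : 0 < K * (M + 2) by rewrite mulr_gt0// ltr_pwDr.
have e10 : 0 < e1 by rewrite divr_gt0.
have [T [_ HT]] : \forall t \near +oo, `|d t| <= e1.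
  by move/cvgr0Pnorm_le : d0; exact.
pose a := Num.max 1 (T + 1).
have a0 : 0 < a by rewrite lt_max ltr01.
have aT t : a <= t -> T < t.
  by rewrite ge_max => /andP[_]; apply: lt_le_trans; rewrite ltrDl.
pose g t := expR (P t - c * Q t) * n t - e1 * (expR (P t) * (Q t + 1)).
have g_le t : a <= t -> g t <= g a.
  apply: (@der_nincr _ g (fun t =>
    expR (P t - c * Q t) * (dn t + (dP t - c * dQ t) * n t)
    - e1 * (expR (P t) * (dP t * (Q t + 1) + dQ t)))) => s as_.
    have s0 : 0 < s := lt_le_trans a0 as_.
    have := P' s s0; have := Q' s s0; have := n' s s0 => ? ? ?.
    by apply: is_derive_eq; rewrite /GRing.scale/=; ring.
  have s0 : 0 < s := lt_le_trans a0 as_.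
  have /andP[Qs0 _] := QM s s0.
  have Ps := dP0 s s0; have Qs := dQ0 s s0.
  rewrite subr_le0.
  (* As Q >= 0, dP + dQ <= dP (Q + 1) + dQ; this is the reason for the [+ 1] in [g]. *)
  apply: (@le_trans _ _ (expR (P s) * (e1 * (dP s + dQ s)))); last first.
    rewrite mulrCA !ler_pM2l ?expR_gt0// lerD2r.
    by rewrite mulrDr mulr1 lerDr mulr_ge0.
  apply: (@le_trans _ _ (expR (P s - c * Q s) * (e1 * (dP s + dQ s)))).
    rewrite ler_pM2l ?expR_gt0//.
    apply: (@le_trans _ _ (d s * (dP s + dQ s))).
      by have := ndn s s0; lra.
    apply: ler_wpM2r; first exact: addr_ge0.
    exact/(le_trans (ler_norm _))/HT/aT.
  apply: ler_wpM2r; first by rewrite mulr_ge0 ?addr_ge0// ltW.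
  by rewrite ler_expR gerBl mulr_ge0.
(* Since exp P >= 1 + P, from some time on [|g a|] is at most e1 exp P. *)
have [T2 [_ HT2]] : \forall t \near +oo, `|g a| / e1 <= P t.
  by move/cvgryPge : Poo; exact.
exists (Num.max a T2); split; first exact: num_real.
move=> t; rewrite gt_max => /andP[/ltW at_ /HT2 Pt].
have t0 : 0 < t := lt_le_trans a0 at_.
rewrite ger0_norm; last exact: n0.
have /andP[Qt0 QtM] := QM t t0.
have h1 : expR (P t - c * Q t) * n t <= e1 * (expR (P t) * (Q t + 1)) + `|g a|.
  by have := g_le t at_; have := ler_norm (g a); rewrite /g; lra.
have h2 : `|g a| <= e1 * expR (P t).
  rewrite mulrC -ler_pdivrMr//; apply: (le_trans Pt).
  by apply: le_trans (expR_ge1Dx _); rewrite lerDr.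
have h3 : expR (P t - c * Q t) * n t <= expR (P t) * (e1 * (M + 2)).
  apply: (le_trans h1).
  have : e1 * (expR (P t) * (Q t + 1)) <= e1 * (expR (P t) * (M + 1)).
    by rewrite !ler_pM2l ?expR_gt0// lerD2r.
  by lra.
have h4 : n t <= expR (c * Q t) * (e1 * (M + 2)).
  rewrite -(ler_pM2l (expR_gt0 (P t - c * Q t))).
  by apply: (le_trans h3); rewrite [leRHS]mulrA -expRD subrK.
apply: (le_trans h4).
have -> : e = K * (e1 * (M + 2)).
  by rewrite /e1; field; rewrite !gt_eqF//= ltr_pwDr.
apply: ler_wpM2r; first by rewrite mulr_ge0 ?addr_ge0// ltW.
by rewrite ler_expR ler_wpM2l.
Qed.

Lemma sqr_cvg0 {R : realType} (f : R -> R) :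
  f t ^+ 2 @[t --> +oo] --> 0 -> f t @[t --> +oo] --> 0.
Proof.
move=> /cvgr0Pnorm_lt f0; apply/cvgr0Pnorm_lt => e e0.
have e20 : 0 < e ^+ 2 by rewrite exprn_gt0.
apply: filterS (f0 _ e20) => t; rewrite normrX.
by rewrite ltr_pXn2r// nnegrE// ltW.
Qed.

(** Gronwall for u^2 with P = a t and Q = 0: completing the square gives 2 u h <= a u^2 + h^2 / a,
    so half of the damping survives and h^2 / a^2 is the small factor. *)
Lemma damped_cvg0 {R : realType} (a : R) (u du h : R -> R) :
  0 < a -> (forall t : R, 0 < t -> is_derive t (1 : R) u (du t)) ->
  (forall t : R, 0 < t -> du t = - a * u t + h t) ->
  h t @[t --> +oo] --> 0 -> u t @[t --> +oo] --> 0.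
Proof.
move=> a0 u' duE h0; apply: sqr_cvg0.
pose d t := (h t ^+ 2) / a ^+ 2.
apply: (@gronwall_cvg0 R (fun t => a * t) (cst a) (cst 0) (cst 0)
  (fun t => u t ^+ 2) (fun t => 2 * u t * du t) d 0 0) => //=.
- by move=> t t0; apply: is_derive_eq; rewrite /GRing.scale/= mulr1.
- move=> t t0; have := u' t t0 => ?.
  by apply: is_derive_eq; rewrite /GRing.scale/=; ring.
- by move=> *; exact: ltW.
- by move=> *; rewrite lexx.
- by move=> *; exact: sqr_ge0.
- by apply: gt0_cvgMry => //; exact: cvg_id.
- rewrite /d -(mul0r (a ^+ 2)^-1) -(mulr0 0).
  by apply: cvgMl; under eq_fun do rewrite expr2; exact: cvgM.
- move=> t t0; rewrite duE// mulr0 mul0r !addr0.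
  have -> : d t * a = h t ^+ 2 / a by rewrite /d; field; exact: lt0r_neq0.
  rewrite -subr_ge0.
  have -> : - a * u t ^+ 2 + h t ^+ 2 / a - 2 * u t * (- a * u t + h t)
    = (a * u t - h t) ^+ 2 / a by field; exact: lt0r_neq0.
  by rewrite divr_ge0 ?sqr_ge0// ltW.
Qed.

(** * The damped oscillator in the rotating frame *)

Section oscillator.
Context {R : realType} (w M B : R) (p dp P Q x u y C S : R -> R).
Hypotheses (w0 : 0 < w)
  (p' : forall t : R, 0 < t -> is_derive t (1 : R) p (dp t))
  (pB : forall t : R, 0 < t -> p t <= B)
  (p0 : forall t : R, 0 < t -> 0 < p t) (dp0 : forall t : R, 0 < t -> dp t < 0)
  (P' : forall t : R, 0 < t -> is_derive t (1 : R) P (2^-1 * p t))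
  (Poo : P t @[t --> +oo] --> +oo)
  (Q' : forall t : R, 0 < t ->
    is_derive t (1 : R) Q (4^-1 * p t ^+ 2 - 2^-1 * dp t))
  (QM : forall t : R, 0 < t -> 0 <= Q t <= M)
  (x' : forall t : R, 0 < t -> is_derive t (1 : R) x (u t + y t))
  (u' : forall t : R, 0 < t -> is_derive t (1 : R) u
    (- p t * (u t + y t) - w ^+ 2 * x t + w ^+ 2 * y t))
  (C' : forall t : R, 0 < t ->
    is_derive t (1 : R) C (cos (w * t) * y t - 2^-1 * p t * C t))
  (S' : forall t : R, 0 < t ->
    is_derive t (1 : R) S (sin (w * t) * y t - 2^-1 * p t * S t)).

(** Adding p x / 2 splits the damping evenly: x and [U] both get the rate p / 2, so the damping
    stays scalar when the pair (w x, U) is rotated. *)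
Let U t := u t + 2^-1 * p t * x t.
Let a1 t := w * x t * cos (w * t) - U t * sin (w * t).
Let a2 t := w * x t * sin (w * t) + U t * cos (w * t).
(** [C] and [S] decay at the same rate p / 2, driven by y cos and y sin, so these combinations
    cancel exactly the forcing terms in which y enters without the factor p. *)
Let r1 t := a1 t - w * C t + w ^+ 2 * S t.
Let r2 t := a2 t - w * S t - w ^+ 2 * C t.
Let n t := r1 t ^+ 2 + r2 t ^+ 2.
(** The forcing that remains. Since dp < 0, the coefficient of x is bounded in absolute value by p^2
    / 4 - dp / 2, the derivative of [Q]. *)
Let th t := 2^-1 * p t * y t - (4^-1 * p t ^+ 2 + 2^-1 * dp t) * x t.

Let r1' (t : R) : 0 < t ->
  is_derive t (1 : R) r1 (- (2^-1 * p t) * r1 t + th t * sin (w * t)).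
Proof.
move=> t0; have := p' t t0; have := x' t t0; have := u' t t0; have := C' t t0.
have := S' t t0 => ? ? ? ? ?.
by apply: is_derive_eq; rewrite /GRing.scale/= /r1 /a1 /U /th; field.
Qed.

Let r2' (t : R) : 0 < t ->
  is_derive t (1 : R) r2 (- (2^-1 * p t) * r2 t - th t * cos (w * t)).
Proof.
move=> t0; have := p' t t0; have := x' t t0; have := u' t t0; have := C' t t0.
have := S' t t0 => ? ? ? ? ?.
by apply: is_derive_eq; rewrite /GRing.scale/= /r2 /a2 /U /th; field.
Qed.

(** The bound on x^2 serves both directions: c = 0 and d = x^2 when x is known to vanish, d built
    from [C] and [S] when they are. Young's inequality costs half of the damping p and leaves the
    rate p / 2 of [P]. *)
Let n_cvg0 (c : R) (d : R -> R) : 0 <= c -> (forall t, 0 <= d t) ->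
  (forall t : R, 0 < t -> x t ^+ 2 <= c * n t + d t) ->
  d t @[t --> +oo] --> 0 -> y t @[t --> +oo] --> 0 -> n t @[t --> +oo] --> 0.
Proof.
move=> c0 d0 xn dcvg ycvg.
(* The coordinate of (r1, r2) along the unit vector (sin, - cos) in which [th] acts; hence s^2 <=
   n. *)
pose s t := r1 t * sin (w * t) - r2 t * cos (w * t).
apply: (@gronwall_cvg0 R P _ Q _ n (fun t => - p t * n t + 2 * th t * s t)
  (fun t => y t ^+ 2 + d t) (c + 1) M P' Q') => //.
- move=> t t0; have := r1' t t0; have := r2' t t0 => ? ?.
  by apply: is_derive_eq; rewrite /GRing.scale/= /n /s; field.
- by move=> t t0; rewrite mulr_ge0// ltW// p0.
- move=> t t0; have := dp0 t t0; have := sqr_ge0 (p t); lra.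
- by move=> t _; rewrite addr_ge0// sqr_ge0.
- by rewrite addr_ge0.
- rewrite -(addr0 0); apply: cvgD => //; rewrite -(mulr0 0).
  by under eq_fun do rewrite expr2; exact: cvgM.
- move=> t t0.
  have sn : s t ^+ 2 <= n t.
    rewrite -subr_ge0.
    have -> : n t - s t ^+ 2 = (r1 t * cos (w * t) + r2 t * sin (w * t)) ^+ 2.
      have -> : n t = (r1 t ^+ 2 + r2 t ^+ 2) * (cos (w * t) ^+ 2 + sin (w * t) ^+ 2).
        by rewrite cos2Dsin2 mulr1.
      by rewrite /s; ring.
    exact: sqr_ge0.
  have k0 : 0 <= 4^-1 * p t ^+ 2 - 2^-1 * dp t.
    by have := dp0 t t0; have := sqr_ge0 (p t); lra.
  have pt := p0 t t0; have dpt := dp0 t t0; have xt := xn _ t0; have dt := d0 t.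
  (* Young's inequality for the three products in 2 th s, with the nonnegative weights p / 2, p^2 /
     4 and - dp / 2. *)
  have h : 2 * th t * s t <= 2^-1 * p t * (y t ^+ 2 + s t ^+ 2)
      + (4^-1 * p t ^+ 2 - 2^-1 * dp t) * (x t ^+ 2 + s t ^+ 2).
    rewrite -subr_ge0.
    have -> : 2^-1 * p t * (y t ^+ 2 + s t ^+ 2)
      + (4^-1 * p t ^+ 2 - 2^-1 * dp t) * (x t ^+ 2 + s t ^+ 2) - 2 * th t * s t
      = 2^-1 * p t * (y t - s t) ^+ 2 + 4^-1 * p t ^+ 2 * (x t + s t) ^+ 2
        - 2^-1 * dp t * (x t - s t) ^+ 2 by rewrite /th; field.
    have h1 : 0 <= p t * (y t - s t) ^+ 2 by rewrite mulr_ge0 ?sqr_ge0// ltW.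
    have h2 : 0 <= p t ^+ 2 * (x t + s t) ^+ 2 by rewrite mulr_ge0// sqr_ge0.
    have h3 : dp t * (x t - s t) ^+ 2 <= 0.
      by rewrite mulr_le0_ge0 ?sqr_ge0// ltW.
    by lra.
  apply: (le_trans (lerD (lexx _) h)).
  set k := 4^-1 * p t ^+ 2 - _ in k0 h *.
  have h1 : k * (x t ^+ 2 + s t ^+ 2) <= k * (c * n t + d t + n t).
    by rewrite ler_wpM2l// lerD.
  have h2 : 2^-1 * p t * (y t ^+ 2 + s t ^+ 2) <= 2^-1 * p t * (y t ^+ 2 + n t).
    by rewrite ler_pM2l ?lerD2l// mulr_gt0.
  have h3 : 0 <= 2^-1 * p t * d t by rewrite !mulr_ge0// ltW.
  have h4 : 0 <= k * y t ^+ 2 by rewrite mulr_ge0// sqr_ge0.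
  by lra.
Qed.

Let cvg0M (f g : R -> R) (K : R) : (forall t : R, 0 < t -> `|g t| <= K) ->
  f t @[t --> +oo] --> 0 -> f t * g t @[t --> +oo] --> 0.
Proof.
move=> gK /cvgr0Pnorm_le f0; apply/cvgr0Pnorm_le => e e0.
have K1 : 0 < `|K| + 1 by rewrite ltr_pwDr.
have eK : 0 < e / (`|K| + 1) by rewrite divr_gt0.
near=> t; rewrite normrM.
have t0 : 0 < t by near: t; exact: nbhs_pinfty_gt.
have ft : `|f t| <= e / (`|K| + 1) by near: t; exact: f0.
apply: (@le_trans _ _ (e / (`|K| + 1) * (`|K| + 1))).
  apply: ler_pM => //; apply: (le_trans (gK t t0)).
  by rewrite (le_trans (ler_norm _))// lerDl.
by rewrite divfK// gt_eqF.
Unshelve. all: by end_near. Qed.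

Let cos1 (t : R) : 0 < t -> `|cos (w * t)| <= 1.
Proof. by move=> _; rewrite ler_norml cos_geN1 cos_le1. Qed.

Let sin1 (t : R) : 0 < t -> `|sin (w * t)| <= 1.
Proof. by move=> _; rewrite ler_norml sin_geN1 sin_le1. Qed.

Let cvg0Z (f : R -> R) (k : R) :
  f t @[t --> +oo] --> 0 -> k * f t @[t --> +oo] --> 0.
Proof. by move=> f0; rewrite -(mulr0 k); apply: cvgMr. Qed.

Let cvg0D (f g : R -> R) : f t @[t --> +oo] --> 0 -> g t @[t --> +oo] --> 0 ->
  f t + g t @[t --> +oo] --> 0.
Proof. by move=> f0 g0; rewrite -(addr0 0); exact: cvgD. Qed.

Let cvg0B (f g : R -> R) : f t @[t --> +oo] --> 0 -> g t @[t --> +oo] --> 0 ->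
  f t - g t @[t --> +oo] --> 0.
Proof. by move=> f0 g0; rewrite -(subr0 0); exact: cvgB. Qed.

Let r_cvg0 : n t @[t --> +oo] --> 0 ->
  r1 t @[t --> +oo] --> 0 /\ r2 t @[t --> +oo] --> 0.
Proof.
move=> n0; split; apply: sqr_cvg0; (apply: (squeeze_cvgr _ (cvg_cst 0) n0));
  apply: nearW => t; rewrite sqr_ge0/= /n ?lerDl ?lerDr sqr_ge0//.
Qed.

Let pcvg0 (f : R -> R) : f t @[t --> +oo] --> 0 ->
  2^-1 * p t * f t @[t --> +oo] --> 0.
Proof.
move=> f0; under eq_fun do rewrite mulrC; apply: (@cvg0M _ _ (2^-1 * B)) => //.
move=> t t0; rewrite ger0_norm ?ler_pM2l// ?pB// mulr_ge0// ltW// p0//.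
Qed.

Let a_cvg0 : x t @[t --> +oo] --> 0 -> u t @[t --> +oo] --> 0 ->
  a1 t @[t --> +oo] --> 0 /\ a2 t @[t --> +oo] --> 0.
Proof.
move=> x0 u0.
have U0 : U t @[t --> +oo] --> 0 by apply: cvg0D => //; exact: pcvg0.
split.
  by apply: cvg0B; [apply: (cvg0M _ _ 1 cos1); exact: cvg0Z|exact: (cvg0M _ _ 1 sin1)].
by apply: cvg0D; [apply: (cvg0M _ _ 1 sin1); exact: cvg0Z|exact: (cvg0M _ _ 1 cos1)].
Qed.

Lemma oscillator_cvg0 : y t @[t --> +oo] --> 0 ->
  (C t @[t --> +oo] --> 0 /\ S t @[t --> +oo] --> 0) <->
  (x t @[t --> +oo] --> 0 /\ u t @[t --> +oo] --> 0).
Proof.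
move=> y0; have wn0 : w != 0 by rewrite gt_eqF.
(* The parts of [r1] and [r2] that come from [C] and [S]: r = a + b. *)
pose b1 t := - w * C t + w ^+ 2 * S t.
pose b2 t := - w * S t - w ^+ 2 * C t.
(* The rotation preserves (w x)^2 + U^2. *)
have wE t : (w * x t) ^+ 2 <= a1 t ^+ 2 + a2 t ^+ 2.
  rewrite -subr_ge0 (_ : _ - _ = U t ^+ 2) ?sqr_ge0//.
  have E := cos2Dsin2 (w * t).
  transitivity ((w ^+ 2 * x t ^+ 2 + U t ^+ 2) *
    (cos (w * t) ^+ 2 + sin (w * t) ^+ 2) - (w * x t) ^+ 2).
    by rewrite /a1 /a2; ring.
  by rewrite E; ring.
split=> [[C0 S0]|[x0 u0]].
  have b10 : b1 t @[t --> +oo] --> 0 by apply: cvg0D; exact: cvg0Z.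
  have b20 : b2 t @[t --> +oo] --> 0 by apply: cvg0B; exact: cvg0Z.
  have n0 : n t @[t --> +oo] --> 0.
    (* The factor 2 / w^2 comes from [wE] and (r - b)^2 <= 2 r^2 + 2 b^2. *)
    apply: (@n_cvg0 (2 / w ^+ 2) (fun t => 2 / w ^+ 2 * (b1 t ^+ 2 + b2 t ^+ 2)))
      => //.
    - by rewrite divr_ge0// sqr_ge0.
    - by move=> t; rewrite mulr_ge0 ?addr_ge0 ?sqr_ge0// divr_ge0// sqr_ge0.
    - move=> t _; rewrite -mulrDr mulrAC ler_pdivlMr ?exprn_gt0//.
      rewrite [leLHS](_ : _ = (w * x t) ^+ 2); last by ring.
      apply: (le_trans (wE t)).
      have -> : a1 t = r1 t - b1 t by rewrite /r1 /b1; ring.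
      have -> : a2 t = r2 t - b2 t by rewrite /r2 /b2; ring.
      have := sqr_ge0 (r1 t + b1 t); have := sqr_ge0 (r2 t + b2 t).
      by rewrite /n; lra.
    - apply: cvg0Z; apply: cvg0D; under eq_fun do rewrite expr2;
        by rewrite -(mulr0 0); exact: cvgM.
  have [r10 r20] := r_cvg0 n0.
  have a10 : a1 t @[t --> +oo] --> 0.
    rewrite (_ : a1 = fun t => r1 t - b1 t); first exact: cvg0B.
    by apply/funext => t; rewrite /r1 /b1; ring.
  have a20 : a2 t @[t --> +oo] --> 0.
    rewrite (_ : a2 = fun t => r2 t - b2 t); first exact: cvg0B.
    by apply/funext => t; rewrite /r2 /b2; ring.
  have x0 : x t @[t --> +oo] --> 0.
    (* The inverse rotation recovers w x, and further on [U], from [a1] and [a2]. *)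
    rewrite (_ : x = fun t => w^-1 * (a1 t * cos (w * t) + a2 t * sin (w * t))).
      by apply: cvg0Z; apply: cvg0D; [exact: (cvg0M _ _ 1 cos1)|exact: (cvg0M _ _ 1 sin1)].
    apply/funext => t; transitivity (w^-1 * (w * x t *
        (cos (w * t) ^+ 2 + sin (w * t) ^+ 2))).
      by rewrite cos2Dsin2; field.
    by rewrite /a1 /a2; ring.
  split=> //.
  rewrite (_ : u = fun t => a2 t * cos (w * t) - a1 t * sin (w * t)
     - 2^-1 * p t * x t).
    apply: cvg0B; last exact: pcvg0.
    by apply: cvg0B; [exact: (cvg0M _ _ 1 cos1)|exact: (cvg0M _ _ 1 sin1)].
  apply/funext => t; transitivity (U t *
        (cos (w * t) ^+ 2 + sin (w * t) ^+ 2) - 2^-1 * p t * x t).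
    by rewrite cos2Dsin2 /U; ring.
  by rewrite /a1 /a2; ring.
have [a10 a20] := a_cvg0 x0 u0.
have [r10 r20] : r1 t @[t --> +oo] --> 0 /\ r2 t @[t --> +oo] --> 0.
  apply: r_cvg0; apply: (@n_cvg0 0 (fun t => x t ^+ 2)) => //.
  - by move=> t; exact: sqr_ge0.
  - by move=> t _; rewrite mul0r add0r.
  - by under eq_fun do rewrite expr2; rewrite -(mulr0 0); exact: cvgM.
have b10 : b1 t @[t --> +oo] --> 0.
  rewrite (_ : b1 = fun t => r1 t - a1 t); first exact: cvg0B.
  by apply/funext => t; rewrite /r1 /b1; ring.
have b20 : b2 t @[t --> +oo] --> 0.
  rewrite (_ : b2 = fun t => r2 t - a2 t); first exact: cvg0B.
  by apply/funext => t; rewrite /r2 /b2; ring.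
(* [b1] and [b2] are linear in (C, S) with determinant w^2 (1 + w^2), which is nonzero, so the
   system can be solved. *)
have w1 : 1 + w ^+ 2 != 0 by rewrite gt_eqF// ltr_pwDl// sqr_ge0.
split.
  rewrite (_ : C = fun t => - (w * (1 + w ^+ 2))^-1 * (b1 t + w * b2 t)).
    by apply: cvg0Z; apply: cvg0D => //; exact: cvg0Z.
  by apply/funext => t; rewrite /b1 /b2; field; rewrite w1.
rewrite (_ : S = fun t => (w * (1 + w ^+ 2))^-1 * (w * b1 t - b2 t)).
  by apply: cvg0Z; apply: cvg0B => //; exact: cvg0Z.
by apply/funext => t; rewrite /b1 /b2; field; rewrite w1.
Qed.

(** Writing w^2 y as w^2 (u + y) - w^2 u turns the equation for u into one with damping w^2 whose
    forcing involves only x and x' = u + y. *)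
Lemma oscillator_damped_cvg0 :
  x t @[t --> +oo] --> 0 -> u t + y t @[t --> +oo] --> 0 ->
  u t @[t --> +oo] --> 0.
Proof.
move=> x0 v0; apply: (@damped_cvg0 R (w ^+ 2) u _
  (fun t => w ^+ 2 * (u t + y t) - 2 * (2^-1 * p t * (u t + y t))
     - w ^+ 2 * x t) _ u') => //.
- by rewrite exprn_gt0.
- by move=> t _; field.
- apply: cvg0B; last exact: cvg0Z.
  by apply: cvg0B; apply: cvg0Z => //; exact: pcvg0.
Qed.

End oscillator.

(** * Integrals from 0 of locally integrable functions *)

Section integral_from_0.
Context {R : realType}.
Local Notation mu := (@lebesgue_measure R).
Implicit Types (f E : R -> R) (a b t l : R).

Lemma within_integrable_itv f a b :
  {within `[a, b], continuous f} -> mu.-integrable `[a, b] (EFin \o f).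
Proof.
by move=> cf; apply: continuous_compact_integrable => //; exact: segment_compact.
Qed.

Lemma Rintegral_within_continuous f t : loc_integrable f ->
  {within `[0, t], continuous (fun s => Rintegral mu `[0, s] f)}.
Proof.
move=> lf; have [t0|t0] := leP 0 t.
  exact: (parameterized_integral_continuous _ (lf t t0)).
by rewrite set_itv_ge ?bnd_simp -?ltNge//; exact: continuous_subspace0.
Qed.

Lemma within_continuous_pos f t : (forall b, {within `[0, b], continuous f}) ->
  0 < t -> {for t, continuous f}.
Proof.
move=> cf t0; have t1 : 0 < t + 1 by rewrite addr_gt0.
apply: (within_continuous_continuous t1 (cf (t + 1))).
by rewrite in_itv/= t0 ltrDl ltr01.
Qed.

Lemma Rintegral_is_derive f t : loc_integrable f -> 0 < t ->
  {for t, continuous f} ->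
  is_derive t (1 : R) (fun s => Rintegral mu `[0, s] f) (f t).
Proof.
move=> lf t0 ft.
have t1 : 0 <= t + 1 by rewrite addr_ge0// ltW.
have tt1 : t < t + 1 by rewrite ltrDl.
have [d dE] := continuous_FTC1_closed tt1 (lf _ t1) t0 ft.
by apply: DeriveDef; [exact: d|rewrite -derive1E; exact: dE].
Qed.

Lemma loc_integrable_itv f a b : loc_integrable f -> 0 <= a ->
  mu.-integrable `]a, b] (EFin \o f).
Proof.
move=> lf a0; have [ab|ab] := leP a b.
  apply: integrableS (lf b (le_trans a0 ab)) => //.
  by move=> s; rewrite /= !in_itv/= => /andP[/ltW/(le_trans a0)->].
by rewrite set_itv_ge ?bnd_simp -?leNgt ?ltW//; exact: integrable_set0.
Qed.

Lemma Rintegral_increment f a b : loc_integrable f -> 0 <= a -> a <= b ->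
  Rintegral mu `[0, b] f - Rintegral mu `[0, a] f = Rintegral mu `]a, b] f.
Proof.
move=> lf a0 ab; rewrite Rintegral_itvB ?bnd_simp//.
exact: lf (le_trans a0 ab).
Qed.

(** The left side is the integral of (E - c) f, where E and c both lie in [E a, E b]. A free [c]
    allows the value of E at either endpoint. *)
Lemma ibp_increment E f c a b : {homo E : r s / r <= s} ->
  loc_integrable f -> loc_integrable (fun s => E s * f s) ->
  0 <= a -> a <= b -> E a <= c <= E b ->
  `|Rintegral mu `]a, b] (fun s => E s * f s) - c * Rintegral mu `]a, b] f|
  <= (E b - E a) * Rintegral mu `]a, b] (fun s => `|f s|).
Proof.
move=> mE lf lEf a0 ab /andP[ac cb].
have If := loc_integrable_itv f a b lf a0.
have IEf := loc_integrable_itv _ a b lEf a0.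
have Icf : mu.-integrable `]a, b] (EFin \o (fun s => c * f s)).
  by apply: eq_integrable (integrableZl _ c If).
have Iaf : mu.-integrable `]a, b] (EFin \o (fun s => `|f s|)).
  exact: (integrable_norm If).
have -> : Rintegral mu `]a, b] (fun s => E s * f s) - c * Rintegral mu `]a, b] f
    = Rintegral mu `]a, b] (fun s => E s * f s - c * f s).
  by rewrite (RintegralB _ IEf Icf)// (RintegralZl c _ If).
have ID : mu.-integrable `]a, b] (EFin \o (fun s => E s * f s - c * f s)).
  by apply: eq_integrable (integrableB _ IEf Icf).
apply: (le_trans (le_normr_Rintegral _ ID)) => //.
rewrite -(RintegralZl (E b - E a) _ Iaf)//; apply: le_Rintegral => //.
- exact: (integrable_norm ID).
- by apply: eq_integrable (integrableZl _ (E b - E a) Iaf).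
- move=> s; rewrite /= in_itv/= => /andP[as_ sb].
  rewrite -mulrBl normrM ler_wpM2r//.
  have := mE _ _ (ltW as_); have := mE _ _ sb.
  by rewrite ler_norml; lra.
Qed.

(* Integration by parts for an integrand that is only locally integrable: near
   [t] the increment of [int E f - E (F - F t)] is at most the product of the
   increments of [E] and of [int |f|], hence [o(|s - t|)]. *)
Lemma ibp_is_derive E dE f t : {homo E : r s / r <= s} ->
  loc_integrable f -> loc_integrable (fun s => E s * f s) -> 0 < t ->
  is_derive t (1 : R) E dE ->
  is_derive t (1 : R) (fun s => Rintegral mu `[0, s] (fun r => E r * f r)
      - E s * Rintegral mu `[0, s] f)
    (- dE * Rintegral mu `[0, t] f).
Proof.
move=> mE lf lEf t0 E'.
pose F s := Rintegral mu `[0, s] f.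
pose G s := Rintegral mu `[0, s] (fun r => E r * f r).
pose L s := Rintegral mu `[0, s] (fun r => `|f r|).
have laf : loc_integrable (fun s => `|f s|).
  by move=> s s0; exact: (integrable_norm (lf s s0)).
(* Freezing [F t] isolates the second-order part: [D] has derivative 0 at t, and the function of the
   statement is [D] minus the differentiable term E (F t). *)
pose D s := G s - E s * F s + E s * F t.
have L0 a b : 0 <= Rintegral mu `]a, b] (fun s => `|f s|).
  exact: Rintegral_ge0.
have FE a b : 0 <= a -> a <= b -> F b - F a = Rintegral mu `]a, b] f.
  exact: Rintegral_increment.
have GE a b : 0 <= a -> a <= b ->
    G b - G a = Rintegral mu `]a, b] (fun r => E r * f r).
  exact: Rintegral_increment.
have LE a b : 0 <= a -> a <= b ->
    L b - L a = Rintegral mu `]a, b] (fun r => `|f r|).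
  exact: Rintegral_increment.
have E0 a b : a <= b -> `|E b - E a| = E b - E a.
  by move=> ab; rewrite ger0_norm// subr_ge0 mE.
have DE s : 0 <= s -> `|D s - D t| <= `|E s - E t| * `|L s - L t|.
  move=> s0; have [ts|/ltW st] := leP t s.
    have -> : D s - D t = (G s - G t) - E s * (F s - F t) by rewrite /D; ring.
    have t0' := ltW t0.
    rewrite (E0 _ _ ts) (GE _ _ t0' ts) (FE _ _ t0' ts) (LE _ _ t0' ts).
    rewrite (ger0_norm (L0 _ _)).
    by apply: ibp_increment => //; rewrite ?(ltW t0)// lexx mE.
  have -> : D s - D t = - ((G t - G s) - E s * (F t - F s)) by rewrite /D; ring.
  rewrite normrN (distrC (L s)) (distrC (E s)).
  rewrite (E0 _ _ st) (GE _ _ s0 st) (FE _ _ s0 st) (LE _ _ s0 st).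
  rewrite (ger0_norm (L0 _ _)).
  by apply: ibp_increment => //; rewrite lexx mE.
have L' : {for t, continuous L}.
  by apply: within_continuous_pos t0 => b; exact: Rintegral_within_continuous.
have D' : is_derive t (1 : R) D 0.
  have cD : h^-1 *: ((D \o shift t) (h *: 1) - D t) @[h --> 0^'] --> (0 : R).
    apply: norm_cvg0.
    have cE : h^-1 *: ((E \o shift t) (h *: 1) - E t) @[h --> 0^'] --> dE.
      by case: E' => dE' <-; exact: dE'.
    have cL : L (h + t) - L t @[h --> 0^'] --> (0 : R).
      rewrite -[X in _ --> X](subrr (L t)); apply: cvgB; last exact: cvg_cst.
      have : L (h + t) @[h --> 0] --> L t.
        have ct : h + t @[h --> (0 : R)] --> t.
          by rewrite -[X in _ --> X]add0r; apply: cvgD; [exact: cvg_id|exact: cvg_cst].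
        exact: cvg_comp ct L'.
      by apply: cvg_trans; apply: cvg_app; exact: nbhs_dnbhs.
    (* The difference quotient of [E] stays bounded while the increment of [L] vanishes. *)
    have c0 : `|h^-1 *: ((E \o shift t) (h *: 1) - E t)| * `|L (h + t) - L t|
        @[h --> 0^'] --> `|dE| * `|0 : R|.
      by apply: cvgM; exact: cvg_norm.
    rewrite normr0 mulr0 in c0.
    apply: squeeze_cvgr (cvg_cst 0) c0.
    near=> h; rewrite normr_ge0/= !normrM -mulrA ler_wpM2l//.
    rewrite /= -[X in X + t]/(h * 1) mulr1; apply: DE.
    (* Keeps h + t nonnegative, as [DE] requires. *)
    have : `|h| < t by near: h; exact: dnbhs0_lt.
    by rewrite ltr_norml => /andP[ht _]; rewrite -lerBlDr sub0r ltW.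
  by split; [exact: cvgP cD|exact: (cvg_lim (@norm_hausdorff _ _) cD)].
rewrite (_ : (fun s => _) = (fun s => D s - E s * F t)); last first.
  by apply/funext => s; rewrite /D addrK.
by apply: is_derive_eq; rewrite /GRing.scale/= -/(F t); ring.
Unshelve. all: by end_near. Qed.

Let integral_itv_fin f t : {within `[0, +oo[, continuous f} ->
  (Rintegral mu `[0, t] f)%:E = (\int[mu]_(s in `[0%R, t]) (f s)%:E)%E.
Proof.
move=> cf; rewrite /Rintegral fineK//; apply: integrable_fin_num => //.
by apply: within_integrable_itv; apply: continuous_subspaceW cf; exact: subset_itvl.
Qed.

Let measurable_pos f : {within `[0, +oo[, continuous f} ->
  measurable_fun (`[0, +oo[ : set R) f.
Proof. by move=> cf; exact: subspace_continuous_measurable_fun. Qed.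

(** Monotone convergence along the intervals [0, n] passes any level at some integer; monotonicity
    in t does the rest. *)
Lemma Rintegral_cvgy f : {within `[0, +oo[, continuous f} ->
  (forall t, 0 <= t -> 0 <= f t) ->
  (\int[mu]_(t in `[0%R, +oo[) (f t)%:E = +oo)%E ->
  Rintegral mu `[0, t] f @[t --> +oo] --> +oo.
Proof.
move=> cf f0 foo; apply/cvgryPge => A.
have mf := measurable_pos _ cf.
have sub (r : R) : `[0, r]%classic `<=` `[0, +oo[%classic by exact: subset_itvl.
have : (\int[mu]_(s in `[0%R, n%:R]) (f s)%:E @[n --> \oo] --> +oo)%E.
  rewrite -foo itv_bndy_bigcup_BRight.
  under eq_bigcupr do rewrite add0r.
  have := @ge0_nondecreasing_set_cvg_integral _ (measurableTypeR R) R
    (fun n : nat => `[0%R, n%:R : R]%classic) (EFin \o f) mu.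
  apply.
  - move=> m n mn; rewrite subsetEset; apply: subset_itvl.
    by rewrite bnd_simp ler_nat.
  - by [].
  - by move=> n; apply/measurable_EFinP; apply: measurable_funS mf.
  - by move=> n s /=; rewrite in_itv/= lee_fin => /andP[/f0].
move=> /cvgeyPge /(_ A) [N _ /(_ N (leqnn N))] /=.
rewrite -integral_itv_fin// lee_fin => AN.
exists N%:R; split; first exact: num_real.
move=> t /ltW Nt; apply: (le_trans AN).
rewrite -lee_fin !integral_itv_fin//; apply: ge0_subset_integral => //.
- by apply/measurable_EFinP; apply: measurable_funS mf.
- by move=> s /=; rewrite in_itv/= lee_fin => /andP[/f0].
- by apply: subset_itvl; rewrite bnd_simp.
Qed.

Lemma Rintegral_le_integraly f : {within `[0, +oo[, continuous f} ->
  (forall t, 0 <= t -> 0 <= f t) ->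
  (\int[mu]_(t in `[0%R, +oo[) (f t)%:E < +oo)%E ->
  forall t, Rintegral mu `[0, t] f <= fine (\int[mu]_(t in `[0%R, +oo[) (f t)%:E).
Proof.
move=> cf f0 foo t; rewrite -lee_fin integral_itv_fin// fineK; last first.
  rewrite ge0_fin_numE//; apply: integral_ge0 => s /=.
  by rewrite in_itv/= lee_fin => /andP[/f0].
apply: ge0_subset_integral => //.
- by apply/measurable_EFinP; exact: measurable_pos.
- by move=> s /=; rewrite in_itv/= lee_fin => /andP[/f0].
- exact: subset_itvl.
Qed.

End integral_from_0.

(** * Products with continuous functions, and little-o as a limit of quotients *)

Lemma loc_integrable_mul {R : realType} (h f : R -> R) :
  continuous h -> loc_integrable f -> loc_integrable (fun s => h s * f s).
Proof.
move=> ch lf t t0; have h_meas : measurable_fun [set: R] h.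
  exact: continuous_measurable_fun.
have hb : [bounded h s | s in (`[0, t] : set R)].
  have /compact_bounded[N [_ mN]] := continuous_compact
    (continuous_subspaceT ch) (@segment_compact R 0 t).
  by exists N; split; rewrite ?num_real // => ? ? ? ?; exact: mN.
have := @integrableMr _ (measurableTypeR R) R lebesgue_measure `[0%R, t]
  (measurable_itv _) h (EFin \o f) (measurable_funTS h_meas) hb (lf t t0).
exact.
Qed.

Lemma littleo_pinftyP {R : realType} (g A : R -> R) : (forall t, 0 < A t) ->
  g =o_at_pinfty A <-> g t / A t @[t --> +oo] --> 0.
Proof.
move=> A0.
have E e t : (`|g t / A t| <= e) = (`|g t| <= e * `|A t|).
  by rewrite normrM normfV ler_pdivrMr// gtr0_norm.
split=> [/eqoP h|/cvgr0Pnorm_le h].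
  by apply/cvgr0Pnorm_le => e e0; apply: filterS (h e e0) => t; rewrite E.
by apply/eqoP => e e0; apply: filterS (h e e0) => t; rewrite E.
Qed.

Lemma within_continuous_mul {R : realType} (A : set R) (f g : R -> R) :
  {within A, continuous f} -> {within A, continuous g} ->
  {within A, continuous (fun t => f t * g t)}.
Proof. by move=> cf cg t; apply: (@continuousM _ (subspace A) f g); [exact: cf|exact: cg]. Qed.

(** * From the differential equation to the oscillator system *)

Theorem mainTheorem12 (R : realType) (w : R) (p dp f x v : R -> R) :
  0 < w ->
  (* p in C^1([0,oo)), with derivative dp (one-sided at 0) *)
  {within `[0%R, +oo[, continuous p} ->
  (forall t : R, 0 < t -> is_derive t (1 : R) p (dp t)) ->
  {within `[0%R, +oo[, continuous dp} ->
  (forall t : R, 0 <= t -> 0 < p t) ->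
  (forall t : R, 0 <= t -> dp t < 0) ->
  (\int[@lebesgue_measure R]_(t in `[0%R, +oo[) (p t)%:E = +oo)%E ->
  (\int[@lebesgue_measure R]_(t in `[0%R, +oo[) ((p t) ^+ 2)%:E < +oo)%E ->
  loc_integrable f ->
  ode_solution w p f x v ->
  x 0 = 0 -> v 0 = 0 ->
  ( [/\ y1 w f t @[t --> +oo] --> 0,
        (fun t => Rintegral (@lebesgue_measure R) `[0, t]
            (fun s => cos (w * s) * Afun p s * y1 w f s))
          =o_at_pinfty (Afun p) &
        (fun t => Rintegral (@lebesgue_measure R) `[0, t]
            (fun s => sin (w * s) * Afun p s * y1 w f s))
          =o_at_pinfty (Afun p)]
    <->
    (x t @[t --> +oo] --> 0 /\ v t @[t --> +oo] --> 0) ).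
Proof.
move=> w0 cp p' _ p0 dp0 poo p2oo lf ode x00 v00.
pose mu := @lebesgue_measure R.
pose lam := w ^+ 2; pose E s := expR (lam * s).
have E' (t : R) : is_derive t (1 : R) E (lam * E t).
  by apply: is_derive_eq; rewrite /GRing.scale/= mulr1 mulrC.
have cE : continuous E.
  by move=> t; apply: differentiable_continuous; apply/derivable1_diffP; case: (E' t).
have mE : {homo E : r s / r <= s}.
  by move=> r s rs; rewrite ler_expR ler_pM2l// exprn_gt0.
have lEf : loc_integrable (fun s => E s * f s) by exact: loc_integrable_mul.
pose F t := Rintegral mu `[0, t] f.
pose G t := Rintegral mu `[0, t] (fun s => E s * f s).
pose y := y1 w f.
have yE (t : R) : y t = expR (- lam * t) * G t.
  (* For t < 0 the interval is empty and both integrals are 0, so the identity holds on the whole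
     line and gives an equality of functions. *)
  have [t0|t0] := leP 0 t; last first.
    by rewrite /y /y1 /G !set_itv_ge ?bnd_simp -?ltNge// !Rintegral_set0 mulr0.
  rewrite /G -(RintegralZl _ _ (lEf t t0))//.
  apply: eq_Rintegral => s _; rewrite mulrA -expRD; congr (expR _ * _).
  by rewrite /lam; ring.
have wsub (b : R) : `[0%R, b]%classic `<=` `[0%R, +oo[%classic by exact: subset_itvl.
have cpb (b : R) : {within `[0, b], continuous p}.
  by exact: continuous_subspaceW (wsub b) cp.
have cyb (b : R) : {within `[0, b], continuous y}.
  rewrite (_ : y = fun t => expR (- lam * t) * G t); last exact/funext.
  apply: within_continuous_mul; last exact: Rintegral_within_continuous.
  apply: continuous_subspaceT => t; apply: differentiable_continuous.
  by apply/derivable1_diffP; exact: ex_derive.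
have lv : loc_integrable v by move=> t /ode[].
have xE (t : R) : 0 <= t -> x t = Rintegral mu `[0, t] v.
  by move=> /ode[_ _ -> _]; rewrite x00 add0r.
have lg : loc_integrable (fun s => f s - p s * v s - w ^+ 2 * x s).
  by move=> t /ode[].
have vE (t : R) : 0 <= t -> v t = Rintegral mu `[0, t]
    (fun s => f s - p s * v s - w ^+ 2 * x s).
  by move=> /ode[_ _ _ ->]; rewrite v00 add0r.
have cvb (b : R) : {within `[0, b], continuous v}.
  apply: (subspace_eq_continuous _ (Rintegral_within_continuous _ b lg)) => s.
  by rewrite inE/= in_itv/= => /andP[s0 _]; rewrite /from_subspace vE.
have cxb (b : R) : {within `[0, b], continuous x}.
  apply: (subspace_eq_continuous _ (Rintegral_within_continuous _ b lv)) => s.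
  by rewrite inE/= in_itv/= => /andP[s0 _]; rewrite /from_subspace xE.
(* This part of the integrand of v is continuous, so its integral [K] is differentiable; [F] keeps
   the rough forcing. *)
pose k s := p s * v s + w ^+ 2 * x s.
have ckb (b : R) : {within `[0, b], continuous k}.
  apply: within_continuousD; apply: within_continuous_mul => //.
  by apply: continuous_subspaceT => ?; exact: cvg_cst.
have lk : loc_integrable k by move=> t _; exact: within_integrable_itv.
pose K t := Rintegral mu `[0, t] k.
have vFK (t : R) : 0 <= t -> v t = F t - K t.
  move=> t0; rewrite vE// /F /K -(RintegralB _ (lf t t0) (lk t t0))//.
  by apply: eq_Rintegral => s _; rewrite /k opprD addrA.
pose D t := G t - E t * F t.
have D' (t : R) : 0 < t -> is_derive t (1 : R) D (- (lam * E t) * F t).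
  by move=> t0; exact: ibp_is_derive.
have K' (t : R) : 0 < t -> is_derive t (1 : R) K (k t).
  by move=> t0; apply: Rintegral_is_derive => //; exact: within_continuous_pos.
pose X t := Rintegral mu `[0, t] v.
(* Equal to v - y for t >= 0, but written with differentiable terms only: [F] is absorbed in [D], as
   exp (- lam t) D = y - F. *)
pose u t := - K t - expR (- lam * t) * D t.
have EK (t : R) : expR (- lam * t) * E t = 1 by rewrite -expRD mulNr addNr expR0.
have uyE (t : R) : u t + y t = F t - K t.
  by rewrite /u yE /D mulrBr mulrA EK; ring.
have uyv (t : R) : 0 <= t -> u t + y t = v t by move=> t0; rewrite uyE vFK.
have X' (t : R) : 0 < t -> is_derive t (1 : R) X (u t + y t).
  move=> t0; rewrite uyv ?ltW//.
  by apply: Rintegral_is_derive => //; exact: within_continuous_pos.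
have u' (t : R) : 0 < t -> is_derive t (1 : R) u
    (- p t * (u t + y t) - w ^+ 2 * X t + w ^+ 2 * y t).
  move=> t0; have := D' t t0; have := K' t t0 => ? ?.
  have e : expR (- lam * t) * D t = y t - F t.
    by rewrite yE /D mulrBr mulrA EK mul1r.
  apply: is_derive_eq; rewrite /GRing.scale/= uyv ?ltW// -/(X t) /k (xE _ (ltW t0)).
  transitivity (- (p t * v t + w ^+ 2 * X t) + lam * (expR (- lam * t) * D t)
    + lam * (expR (- lam * t) * E t) * F t); first by rewrite /X; ring.
  by rewrite e EK /lam; ring.
have lp : loc_integrable p by move=> t _; exact: within_integrable_itv.
have cp2 : {within `[0%R, +oo[, continuous (fun t => p t ^+ 2)}.
  exact: (within_continuous_mul _ _ _ cp cp).
have cp2b (b : R) : {within `[0, b], continuous (fun t => p t ^+ 2)}.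
  exact: continuous_subspaceW (wsub b) cp2.
have lp2 : loc_integrable (fun t => p t ^+ 2).
  by move=> t _; exact: within_integrable_itv.
pose P t := 2^-1 * Rintegral mu `[0, t] p.
have P' (t : R) : 0 < t -> is_derive t (1 : R) P (2^-1 * p t).
  move=> t0; apply: is_deriveZ; apply: Rintegral_is_derive => //.
  exact: within_continuous_pos.
have Poo : P t @[t --> +oo] --> +oo.
  by apply: gt0_cvgMry => //; apply: Rintegral_cvgy => // t t0; rewrite ltW ?p0.
(* The primitive of p^2 / 4 - p' / 2 vanishing at 0: nonnegative because p decreases, bounded
   because p^2 is integrable and p positive. *)
pose Q t := 4^-1 * Rintegral mu `[0, t] (fun s => p s ^+ 2) + 2^-1 * (p 0 - p t).
have Q' (t : R) : 0 < t -> is_derive t (1 : R) Q (4^-1 * p t ^+ 2 - 2^-1 * dp t).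
  move=> t0; have := p' t t0 => ?.
  have ? : is_derive t (1 : R) (fun s => Rintegral mu `[0, s] (fun s => p s ^+ 2))
      (p t ^+ 2).
    by apply: Rintegral_is_derive => //; exact: (within_continuous_pos _ _ cp2b).
  by apply: is_derive_eq; rewrite /GRing.scale/=; ring.
have pB (t : R) : 0 < t -> p t <= p 0.
  move=> t0; apply: (@ler0_derive1_nincry _ p 0) => //; last exact: ltW.
    by move=> s; rewrite in_itv/= andbT => /p'[].
  move=> s; rewrite in_itv/= andbT => s0.
  by have [_] := p' s s0; rewrite derive1E => ->; rewrite ltW// dp0// ltW.
pose M := 4^-1 * fine (\int[mu]_(t in `[0%R, +oo[) ((p t) ^+ 2)%:E)%E + 2^-1 * p 0.
have QM (t : R) : 0 < t -> 0 <= Q t <= M.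
  move=> t0; apply/andP; split.
    rewrite addr_ge0 ?mulr_ge0 ?invr_ge0 ?subr_ge0 ?pB//.
    by apply: Rintegral_ge0 => s _; exact: sqr_ge0.
  rewrite /Q /M lerD// ler_pM2l//.
    by apply: (Rintegral_le_integraly _ cp2) => // s _; exact: sqr_ge0.
  by rewrite gerBl ltW// p0// ltW.
have A0 (t : R) : 0 < Afun p t by exact: expR_gt0.
have cAb (b : R) : {within `[0, b], continuous Afun p}.
  have cP : {within `[0, b], continuous P}.
    apply: within_continuous_mul; last exact: Rintegral_within_continuous.
    by apply: continuous_subspaceT => ?; exact: cvg_cst.
  by move=> s; apply: continuous_comp; [exact: cP|exact: continuous_expR].
(* Dividing by A = exp P produces the damping term with rate p / 2; [c] will be cos or sin. *)
have Rintegral_mean' (c : R -> R) : continuous c -> forall t : R, 0 < t ->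
    is_derive t (1 : R) (fun t => Rintegral mu `[0, t]
       (fun s => c (w * s) * Afun p s * y s) / Afun p t)
    (c (w * t) * y t - 2^-1 * p t * (Rintegral mu `[0, t]
       (fun s => c (w * s) * Afun p s * y s) / Afun p t)).
  move=> cc t t0.
  have cI (b : R) : {within `[0, b], continuous (fun s => c (w * s) * Afun p s * y s)}.
    apply: within_continuous_mul => //; apply: within_continuous_mul => //.
    apply: continuous_subspaceT => s.
    by apply: continuous_comp; [exact: mulrl_continuous|exact: cc].
  have lI : loc_integrable (fun s => c (w * s) * Afun p s * y s).
    by move=> b _; exact: within_integrable_itv.
  have := Rintegral_is_derive _ _ lI t0 (within_continuous_pos _ _ cI t0).
  set I := fun t => Rintegral mu `[0, t] _ => I'.
  have := P' t t0 => ?.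
  have AN s : (Afun p s)^-1 = expR (- P s) by rewrite expRN.
  rewrite (_ : (fun t => _) = (fun t => I t * expR (- P t))); last first.
    by apply/funext => s; rewrite AN.
  apply: is_derive_eq; rewrite /GRing.scale/=.
  transitivity (c (w * t) * y t * (Afun p t * expR (- P t))
    - 2^-1 * p t * (I t * expR (- P t))); first by ring.
  by rewrite -AN mulfV ?mulr1// gt_eqF.
have C' := Rintegral_mean' cos (@continuous_cos R).
have S' := Rintegral_mean' sin (@continuous_sin R).
have pB' (t : R) : 0 < t -> 0 < p t by move=> /ltW; exact: p0.
have dp0' (t : R) : 0 < t -> dp t < 0 by move=> /ltW; exact: dp0.
have osc := oscillator_cvg0 w M (p 0) p dp P Q X u y _ _ w0 p' pB pB' dp0' P' Poo
  Q' QM X' u' C' S'.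
(* The equation determines x and v only for t >= 0, which suffices for limits at infinity. *)
have xX : x t @[t --> +oo] --> 0 <-> X t @[t --> +oo] --> 0.
  by split; apply: cvg_trans; apply: near_eq_cvg; near=> t; rewrite xE.
have vuy : v t @[t --> +oo] --> 0 <-> u t + y t @[t --> +oo] --> 0.
  by split; apply: cvg_trans; apply: near_eq_cvg; near=> t; rewrite uyv.
split=> [[y0 /(littleo_pinftyP _ _ A0) C0 /(littleo_pinftyP _ _ A0) S0]|].
  have [X0 u0] := (osc y0).1 (conj C0 S0).
  split; [exact/xX|apply/vuy].
  by rewrite -(addr0 0); exact: cvgD.
move=> [/xX X0 /vuy v0].
(* Here y -> 0 must be obtained first, since [osc] presupposes it: y is the difference of x' = u + y
   and u. *)
have u0 := oscillator_damped_cvg0 w (p 0) p X u y w0 pB pB' u' X0 v0.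
have y0 : y t @[t --> +oo] --> 0.
  rewrite (_ : y = fun t => (u t + y t) - u t).
    by rewrite -(subr0 0); exact: cvgB.
  by apply/funext => t; rewrite addrC addKr.
have [C0 S0] := (osc y0).2 (conj X0 u0).
by split=> //; apply/littleo_pinftyP.
Unshelve. all: by end_near. Qed.
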